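(* Let $G=(V,E)$ be a graph with $V=\{1,\dots,n\}$, let $\Sigma\subseteq\mathrm{Aut}(G)$ act transitively on the arcs of $G$, and let $v\colon V\to\mathbb{R}^d$ be a $\Sigma$-realization of $G$ of full local dimension. Then (i) $v$ is irreducible, (ii) $v$ is rigid (in $\mathcal{R}_d(G,\Sigma)$), and (iii) $v$ is balanced.
   Context: $G$ is a finite simple undirected graph; $N(i)$ is the neighbourhood of $i$. An arc is an ordered pair $(i,j)$ with $ij\in E$. A realization $v\colon V\to\mathbb{R}^d$ is of full local dimension if for every $i\in V$ the vectors $\{v_j-v_i: j\in N(i)\}$ span $\mathbb{R}^d$ (this implies the $v_i$ span $\mathbb{R}^d$). It is a $\Sigma$-realization if there is a group homomorphism $T\colon\Sigma\to\mathrm{O}(\mathbb{R}^d)$ with $T_\sigma v_i=v_{\sigma(i)}$ for all $i,\sigma$; irreducible if $T$ has no invariant subspaces other than $\{0\}$ and $\mathbb{R}^d$; balanced if there is $\theta\in\mathbb{R}$ with $\sum_{j\in N(i)}v_j=\theta v_i$ for all $i$. The arrangement space of $v$ is the column span of the matrix $M\in\mathbb{R}^{n\times d}$ with rows $v_i^\top$. $\mathcal{R}_d(G,\Sigma)$ is the set of $d$-dimensional $\Sigma$-realizations whose points span $\mathbb{R}^d$, as a subset of $\mathbb{R}^{n\times d}$ with the subspace topology; two realizations are equivalent if they have the same arrangement space; $v$ is rigid if there is no continuous curve $\gamma\colon[0,1]\to\mathcal{R}_d(G,\Sigma)$ with $\gamma(0)=v$ and $\gamma(1)$ not equivalent to $v$.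 *)

(* Defs.v *)
From mathcomp Require Import all_boot all_order all_algebra all_fingroup.
From mathcomp Require Import mxrepresentation.
From mathcomp Require Import all_classical all_reals all_analysis.

Set Implicit Arguments.
Unset Strict Implicit.
Unset Printing Implicit Defensive.

Import numFieldNormedType.Exports.

Local Open Scope ring_scope.
Local Open Scope classical_set_scope.

Record graph (n : nat) := Graph {
  adj : rel 'I_n;
  adj_sym : symmetric adj;
  adj_irr : irreflexive adj }.

Definition nbhd (n : nat) (G : graph n) (i : 'I_n) : {set 'I_n} :=
  [set j | adj G i j]%SET.

Definition graph_aut (n : nat) (G : graph n) : {set 'S_n} :=
  [set s : 'S_n | [forall i, forall j, adj G (s i) (s j) == adj G i j]]%SET.

Definition arc_transitive (n : nat) (G : graph n) (Sigma : {group 'S_n}) :=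
  forall i j k l : 'I_n, adj G i j -> adj G k l ->
    exists s : 'S_n, [/\ s \in Sigma, s i = k & s j = l].

(* A realization v : V -> R^d is the matrix 'M[R]_(n, d) whose i-th row is
   v_i, so that R^d consists of row vectors and linear maps act on the right.
   Since (s * t) i = t (s i) in 'S_n, an mx_representation acting on the right
   is exactly a homomorphism for the composition of permutations acting on the
   left. *)
Definition realizes (R : realType) (n d : nat) (Sigma : {group 'S_n})
    (T : mx_representation R Sigma d) (v : 'M[R]_(n, d)) :=
  (forall s, s \in Sigma -> T s *m (T s)^T = 1%:M) /\
  (forall s i, s \in Sigma -> row i v *m T s = row (s i) v).

Definition sigma_realization (R : realType) (n d : nat)
    (Sigma : {group 'S_n}) (v : 'M[R]_(n, d)) :=
  exists T : mx_representation R Sigma d, realizes T v.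

Definition full_local_dimension (R : realType) (n d : nat) (G : graph n)
    (v : 'M[R]_(n, d)) :=
  forall i : 'I_n, row_full (\sum_(j in nbhd G i) <<row j v - row i v>>)%MS.

(* Unlike mx_irreducible, this does not exclude d = 0. *)
Definition irreducible_rep (R : realType) (n d : nat) (Sigma : {group 'S_n})
    (T : mx_representation R Sigma d) :=
  forall W : 'M[R]_d, mxmodule T W -> (W :=: (0 : 'M[R]_d))%MS \/
                                      (W :=: (1%:M : 'M[R]_d))%MS.

(* T is determined by v as soon as the points of v span R^d. *)
Definition irreducible_realization (R : realType) (n d : nat)
    (Sigma : {group 'S_n}) (v : 'M[R]_(n, d)) :=
  sigma_realization Sigma v /\
  forall T : mx_representation R Sigma d, realizes T v -> irreducible_rep T.

Definition balanced (R : realType) (n d : nat) (G : graph n)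
    (v : 'M[R]_(n, d)) :=
  exists theta : R, forall i : 'I_n,
    \sum_(j in nbhd G i) row j v = theta *: row i v.

Definition realization_space (R : realType) (n d : nat)
    (Sigma : {group 'S_n}) : set 'M[R]_(n, d) :=
  [set v | sigma_realization Sigma v /\ row_full v].

(* Row spaces of the transposes are the column spans. *)
Definition same_arrangement_space (R : realType) (n d : nat)
    (v w : 'M[R]_(n, d)) := (v^T :=: w^T)%MS.

Definition rigid (R : realType) (n d : nat) (Sigma : {group 'S_n})
    (v : 'M[R]_(n, d)) :=
  ~ exists gamma : R -> 'M[R]_(n, d),
      [/\ {within `[0, 1], continuous gamma},
          forall t : R, 0 <= t <= 1 -> realization_space Sigma (gamma t),
          gamma 0 = v &
          ~ same_arrangement_space (gamma 1) v].

(* Main.v *)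
Require Import Defs.
From mathcomp Require Import all_boot all_order all_algebra all_fingroup pgroup.
From mathcomp Require Import mxrepresentation.
From mathcomp Require Import all_classical all_reals all_analysis.

Set Implicit Arguments.
Unset Strict Implicit.
Unset Printing Implicit Defensive.

Import Order.TTheory GRing.Theory Num.Theory.
Import numFieldNormedType.Exports.

Local Open Scope ring_scope.

(** A vector fixed by the stabiliser of [i] and orthogonal to one difference
    [v_j - v_i], [j] in [N(i)], is orthogonal to all of them, because the
    stabiliser is transitive on [N(i)]; as these differences span, it is zero.
    Hence the vectors fixed by the stabiliser of [i] are the multiples of [v_i],
    and every matrix [w] whose rows are permuted by [T] like those of [v] is a
    scalar multiple of [v].

    Applied to the images of [v] under endomorphisms of [T] this shows that [T]
    has only scalar endomorphisms, so it is irreducible by Maschke's theorem;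
    applied to the sums over neighbourhoods it shows that [v] is balanced.  For
    rigidity, let [w] be another realization.  Then [w^T v] intertwines the two
    representations, so it is zero or, [T] being irreducible, invertible; in the
    latter case [w (w^T v)] is a multiple of [v].  Thus the arrangement space of
    [w] is contained in that of [v] or orthogonal to it.  Both are closed
    conditions and they exclude each other, so along a curve one of them
    persists. *)

Section Matrix.

Lemma mulmx_tr_eq0 (R : realDomainType) (m n : nat) (A : 'M[R]_(m, n)) :
  A *m A^T = 0 -> A = 0.
Proof.
move=> /matrixP AAT0; apply/matrixP => i j; apply/eqP; rewrite mxE.
have /eqP := AAT0 i i; rewrite !mxE psumr_eq0 => [|k _]; last first.
  by rewrite mxE -expr2 sqr_ge0.
by move=> /allP /(_ j (mem_index_enum j)); rewrite mxE mulf_eq0 orbb.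
Qed.

Lemma capmx_tr_kermx (F : realFieldType) (m n : nat) (A : 'M[F]_(m, n)) :
  (A^T :&: kermx A)%MS = 0.
Proof.
set B := (_ :&: _)%MS; apply: mulmx_tr_eq0.
have /submxP[X BE] : (B <= A^T)%MS by exact: capmxSl.
have /sub_kermxP BA0 : (B <= kermx A)%MS by exact: capmxSr.
by rewrite {2}BE trmx_mul trmxK mulmxA BA0 mul0mx.
Qed.

Lemma row_full_sum_ortho_eq0 (F : fieldType) (I : finType) (P : pred I)
    (m n p : nat) (A : I -> 'M[F]_(m, n)) (u : 'M[F]_(p, n)) :
    row_full (\sum_(i | P i) <<A i>>)%MS ->
    (forall i, P i -> u *m (A i)^T = 0) ->
  u = 0.
Proof.
rewrite -sub1mx => Afull uA0; apply: trmx_inj; rewrite trmx0 -[LHS]mul1mx.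
apply/sub_kermxP; apply: submx_trans Afull _; apply/sumsmx_subP => i Pi.
rewrite genmxE; apply/sub_kermxP.
by rewrite -[LHS]trmxK trmx_mul trmxK uA0 // trmx0.
Qed.

End Matrix.

Section Topology.
Local Open Scope classical_set_scope.

Lemma connected_closed_cover (T : topologicalType) (A B K : set T) :
    connected K -> closed A -> closed B -> K `<=` A `|` B ->
    K `&` A `&` B = set0 ->
  K `<=` A \/ K `<=` B.
Proof.
move=> Kconn Aclosed Bclosed KAB KAB0.
have closureIsub (C : set T) : closed C -> closure (K `&` C) `<=` C.
  by move=> /closure_id CE x /(closureS (@subIsetr _ K C)); rewrite -CE.
have sepAB : separated (K `&` A) (K `&` B).
  split; rewrite -subset0 -KAB0 => x.
  - by move=> [/(closureIsub A Aclosed) Ax [Kx Bx]].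
  - by move=> [[Kx Ax] /(closureIsub B Bclosed) Bx].
have KsubU : K `<=` (K `&` A) `|` (K `&` B).
  by rewrite -setIUr => x Kx; split=> //; exact: KAB.
by case: (connected_subset sepAB KsubU Kconn) => KS; [left|right];
  apply: subset_trans KS (@subIsetr _ _ _).
Qed.

Lemma mulmx_entry_continuous (K : numFieldType) (m n p : nat)
    (A : 'M[K]_(m, n)) i j :
  continuous (fun M : 'M[K]_(n, p) => (A *m M) i j).
Proof.
under eq_fun do rewrite mxE.
apply: continuous_big => [|k _ M]; first exact: add_continuous.
by apply: continuousM; [exact: cst_continuous | exact: coord_continuous].
Qed.

Lemma closed_trmx_sub (K : numFieldType) (m n p : nat) (V : 'M[K]_(m, n)) :
  closed [set w : 'M[K]_(n, p) | (w^T <= V)%MS].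
Proof.
rewrite (_ : [set w | _] = \bigcap_(ij in setT)
    (fun w : 'M[K]_(n, p) => ((cokermx V)^T *m w) ij.1 ij.2) @^-1` [set 0]).
  apply: closed_bigI => -[i j] _; apply: preimage_closed => [w _|].
    exact: mulmx_entry_continuous.
  exact/accessible_closed_set1/hausdorff_accessible/norm_hausdorff.
have subE w : (w^T <= V)%MS = ((cokermx V)^T *m w == 0).
  by rewrite submxE -trmx_eq0 trmx_mul trmxK.
apply/seteqP; split=> w; rewrite /= subE.
  by move=> /eqP w0 [i j] _; rewrite /= w0 mxE.
by move=> w0; apply/eqP/matrixP => i j; rewrite (w0 (i, j)) // mxE.
Qed.

End Topology.

Section Intertwiners.
Context {F : comUnitRingType} {gT : finGroupType} {Sigma : {group gT}}.

Definition intertwines (d1 d2 : nat) (T1 : mx_representation F Sigma d1)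
    (T2 : mx_representation F Sigma d2) (f : 'M[F]_(d1, d2)) :=
  {in Sigma, forall s, T1 s *m f = f *m T2 s}.

Definition orthogonal_rep (d : nat) (T : mx_representation F Sigma d) :=
  forall s, s \in Sigma -> T s *m (T s)^T = 1%:M.

Lemma orthogonal_rep_trmx (d : nat) (T : mx_representation F Sigma d) s :
  orthogonal_rep T -> s \in Sigma -> (T s)^T = T s^-1%g.
Proof.
move=> Torth sS; rewrite -[LHS]mul1mx -(repr_mx1 T) -(mulVg s).
by rewrite repr_mxM ?groupV // -mulmxA Torth // mulmx1.
Qed.

End Intertwiners.

Section Equivariance.
Context {F : comUnitRingType} {n : nat} {Sigma : {group 'S_n}}.

Definition equivariant (d : nat) (T : mx_representation F Sigma d)
    (w : 'M[F]_(n, d)) :=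
  forall s i, s \in Sigma -> row i w *m T s = row (s i) w.

Definition spans_equivariant (d : nat) (T : mx_representation F Sigma d)
    (v : 'M[F]_(n, d)) :=
  forall w, equivariant T w -> exists a, w = a *: v.

Lemma equivariant_row_perm (d : nat) (T : mx_representation F Sigma d) w s :
  equivariant T w -> s \in Sigma -> w *m T s = row_perm s w.
Proof.
move=> Tw sS; apply/row_matrixP => i.
by rewrite row_mul Tw // row_permEsub row_rowsub.
Qed.

Lemma equivariant0 (d : nat) (T : mx_representation F Sigma d) :
  equivariant T 0.
Proof. by move=> s i _; rewrite !row0 mul0mx. Qed.

Lemma equivariantZ (d : nat) (T : mx_representation F Sigma d) a w :
  equivariant T w -> equivariant T (a *: w).
Proof. by move=> Tw s i sS; rewrite !linearZ -scalemxAl Tw. Qed.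

Lemma equivariant_mulmx (d1 d2 : nat) (T1 : mx_representation F Sigma d1)
    (T2 : mx_representation F Sigma d2) w f :
  equivariant T1 w -> intertwines T1 T2 f -> equivariant T2 (w *m f).
Proof.
by move=> Tw Tf s i sS; rewrite !row_mul -mulmxA -Tf // mulmxA Tw.
Qed.

Lemma equivariant_sum_nbhd (d : nat) (T : mx_representation F Sigma d)
    (G : graph n) w :
    Sigma \subset graph_aut G -> equivariant T w ->
  equivariant T (\matrix_i \sum_(j in nbhd G i) row j w).
Proof.
move=> /fintype.subsetP Saut Tw s i sS; rewrite !rowK mulmx_suml.
rewrite [RHS](reindex_inj (@perm_inj _ s)).
apply: eq_big => [j|j _]; last exact: Tw.
by have := Saut s sS; rewrite !inE => /forallP /(_ i) /forallP /(_ j) /eqP ->.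
Qed.

Lemma equivariant_row_inj (d : nat) (T : mx_representation F Sigma d) v w i :
    [transitive Sigma, on [set: 'I_n] | 'P]%g ->
    equivariant T v -> equivariant T w -> row i v = row i w ->
  v = w.
Proof.
move=> Strans Tv Tw vwi; apply/row_matrixP => k.
have [s sS ->] := atransP2 Strans (finset.in_setT i) (finset.in_setT k).
by rewrite -['P%act i s]/(s i) -Tv // -Tw // vwi.
Qed.

Lemma orthogonal_mulmx_tr_intertwines (d1 d2 : nat)
    (T1 : mx_representation F Sigma d1) (T2 : mx_representation F Sigma d2)
    v w :
    orthogonal_rep T1 -> equivariant T1 v -> equivariant T2 w ->
  intertwines T1 T2 (v^T *m w).
Proof.
move=> T1orth T1v T2w s sS.
rewrite -[T1 s]trmxK orthogonal_rep_trmx // mulmxA -trmx_mul.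
rewrite (equivariant_row_perm T1v) ?groupV // -mulmxA.
rewrite (equivariant_row_perm T2w) // !row_permE trmx_mul tr_perm_mx invgK.
by rewrite mulmxA.
Qed.

End Equivariance.

Section IrreducibleRealizations.
Context {R : realType} {n d : nat} {Sigma : {group 'S_n}}.
Implicit Types (T : mx_representation R Sigma d) (v w : 'M[R]_(n, d)).

Lemma intertwines_irreducible_eq0_or_row_full (d' : nat) T
    (T' : mx_representation R Sigma d') (f : 'M[R]_(d', d)) :
  irreducible_rep T -> intertwines T' T f -> f = 0 \/ row_full f.
Proof.
move=> Tirr T'f; have modf : mxmodule T <<f>>%MS.
  rewrite (eqmx_module T (genmxE f)); apply/mxmoduleP => s sS.
  by rewrite -T'f // submxMl.
case: (Tirr _ modf) => fE; [left | right].
  by apply/eqP; rewrite -submx0 -fE genmxE.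
by rewrite -sub1mx -fE genmxE.
Qed.

Lemma scalar_centgmx_irreducible T :
  (forall f, centgmx T f -> is_scalar_mx f) -> irreducible_rep T.
Proof.
move=> Tscalar W modW; have Sigma_pchar : ([pchar R]^'.-group Sigma)%g.
  by apply/pgroupP => p _ _; rewrite inE /= pchar_num.
have [W' modW' sumW dxW] := mx_Maschke_pchar T Sigma_pchar modW (submx1 W).
have capW : (W :&: W')%MS = 0 by exact/mxdirect_addsP.
have projW : W *m proj_mx W W' = W by exact: proj_mx_id.
have [|a projE] := is_scalar_mxP (Tscalar (proj_mx W W') _).
  by rewrite -row_full_dom_hom -sub1mx -sumW proj_mx_hom.
have [a0|a_neq0] := eqVneq a 0; [left | right].
  by rewrite -projW projE a0 raddf0 mulmx0.
apply/eqmxP; rewrite submx1 /= -(eqmx_scale 1%:M a_neq0) scalemx1 -projE.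
by rewrite -[X in (X <= _)%MS]mul1mx proj_mx_sub.
Qed.

Lemma spans_equivariant_irreducible T v :
    row_full v -> equivariant T v -> spans_equivariant T v ->
  irreducible_rep T.
Proof.
move=> v_full Tv v_span; apply: scalar_centgmx_irreducible => f /centgmxP Tf.
have [|a vf] := v_span (v *m f).
  by apply: equivariant_mulmx Tv _ => s /Tf.
apply/is_scalar_mxP; exists a.
by apply: (row_full_inj v_full); rewrite vf mul_mx_scalar.
Qed.

Lemma spans_equivariant_balanced (G : graph n) T v :
    Sigma \subset graph_aut G -> equivariant T v -> spans_equivariant T v ->
  balanced G v.
Proof.
move=> Saut Tv /(_ _ (equivariant_sum_nbhd Saut Tv)) [theta sumE].
by exists theta => i; have := congr1 (row i) sumE; rewrite rowK linearZ.
Qed.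

Lemma arrangement_sub_or_ortho T v w :
    irreducible_rep T -> equivariant T v -> spans_equivariant T v ->
    sigma_realization Sigma w ->
  (w^T <= v^T)%MS \/ (w^T <= kermx v)%MS.
Proof.
move=> Tirr Tv v_span [T' [T'orth T'w]].
have hom_wv := orthogonal_mulmx_tr_intertwines T'orth T'w Tv.
have [wv0|wv_full] := intertwines_irreducible_eq0_or_row_full Tirr hom_wv.
  by right; apply/sub_kermxP.
left; have [a wE] := v_span _ (equivariant_mulmx T'w hom_wv).
rewrite -(mulmxK (_ : w^T *m v \in unitmx) w) -?row_full_unit //.
by rewrite wE -scalemxAl scalemxAr trmx_mul submxMl.
Qed.

Lemma same_arrangement_space_sub v w :
  row_full v -> row_full w -> (w^T <= v^T)%MS -> same_arrangement_space w v.
Proof.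
move=> /eqP v_full /eqP w_full wv; apply/eqmxP; rewrite wv /=.
by rewrite -(geq_leqif (mxrank_leqif_sup wv)) !mxrank_tr v_full w_full.
Qed.

Lemma arrangement_sub_not_ortho v w :
    (0 < d)%N -> row_full w -> (w^T <= v^T)%MS ->
  ~~ (w^T <= kermx v)%MS.
Proof.
move=> d_gt0 /eqP w_full wv; apply/negP => w_ortho.
have : (w^T <= (0 : 'M[R]_n))%MS by rewrite -(capmx_tr_kermx v) sub_capmx wv.
by rewrite submx0 -mxrank_eq0 mxrank_tr w_full eqn0Ngt d_gt0.
Qed.

Lemma connected_same_arrangement_space T v (K : set 'M[R]_(n, d)) :
    equivariant T v -> spans_equivariant T v -> connected K ->
    (K `<=` realization_space Sigma)%classic -> K v ->
  forall w, K w -> same_arrangement_space w v.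
Proof.
move=> Tv v_span Kconn Kreal Kv w Kw.
have [[_ v_full] [_ w_full]] := (Kreal v Kv, Kreal w Kw).
have Tirr := spans_equivariant_irreducible v_full Tv v_span.
(* In dimension 0 the two alternatives below are not exclusive. *)
have [d0|d_gt0] := posnP d.
  by rewrite /same_arrangement_space; subst d; rewrite [w]thinmx0 [v]thinmx0.
have [||Ksub|Kortho] := connected_closed_cover Kconn
    (@closed_trmx_sub _ _ _ d v^T) (@closed_trmx_sub _ _ _ d (kermx v)).
- move=> u /Kreal [u_real _].
  exact: arrangement_sub_or_ortho Tirr Tv v_span u_real.
- apply/seteqP; split=> // u [[/Kreal [_ u_full] /= u_sub]].
  exact/negP/arrangement_sub_not_ortho.
- exact: same_arrangement_space_sub v_full w_full (Ksub w Kw).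
- have /negP[] := arrangement_sub_not_ortho d_gt0 v_full (submx_refl v^T).
  exact: Kortho.
Qed.

Lemma spans_equivariant_rigid T v :
  equivariant T v -> spans_equivariant T v -> rigid Sigma v.
Proof.
move=> Tv v_span [g [g_cont g_real g0]]; apply.
have K_conn : connected (g @` `[0, 1])%classic.
  exact: connected_continuous_connected (@segment_connected R 0 1) g_cont.
apply: (connected_same_arrangement_space Tv v_span K_conn).
- by move=> _ [t t01 <-]; apply: g_real; rewrite /= in_itv in t01.
- by exists 0; rewrite //= in_itv /= lexx ler01.
- by exists 1; rewrite //= in_itv /= lexx ler01.
Qed.

End IrreducibleRealizations.

Section ArcTransitive.
Context {R : realType} {n d : nat} (G : graph n) {Sigma : {group 'S_n}}.
Implicit Types (T : mx_representation R Sigma d) (v w : 'M[R]_(n, d)).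

Lemma arc_transitive_atrans :
    (0 < n)%N -> (forall i, exists j, adj G i j) -> arc_transitive G Sigma ->
  [transitive Sigma, on [set: 'I_n] | 'P]%g.
Proof.
move=> n_gt0 has_nbr Sigma_arc; have i0 := Ordinal n_gt0.
apply/imsetP; exists i0; rewrite ?inE //; apply/esym/setP => k; rewrite inE.
have [[j i0j] [l kl]] := (has_nbr i0, has_nbr k).
have [s [sS si0 _]] := Sigma_arc _ _ _ _ i0j kl.
by apply/orbitP; exists s.
Qed.

Lemma full_local_dimension_row_full v :
  (0 < n)%N -> full_local_dimension G v -> row_full v.
Proof.
move=> n_gt0 /(_ (Ordinal n_gt0)); rewrite -!sub1mx => /submx_trans; apply.
by apply/sumsmx_subP => j _; rewrite genmxE addmx_sub ?eqmx_opp // row_sub.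
Qed.

Lemma full_local_dimension_nbr v i :
  (0 < d)%N -> full_local_dimension G v -> exists j, adj G i j.
Proof.
move=> d_gt0 /(_ i); case: (pickP (adj G i)) => [j ij _|no_nbr].
  by exists j.
rewrite /row_full big1 => [|j]; last by rewrite inE no_nbr.
by rewrite mxrank0 eq_sym eqn0Ngt d_gt0.
Qed.

Lemma rfix_stab_ortho_eq0 (p : nat) T v i j (u : 'M[R]_(p, d)) :
    arc_transitive G Sigma -> orthogonal_rep T -> equivariant T v ->
    full_local_dimension G v -> adj G i j ->
    (u <= rfix_mx T 'C_Sigma[i | 'P])%MS ->
    u *m (row j v - row i v)^T = 0 ->
  u = 0.
Proof.
move=> Sigma_arc Torth Tv v_full ij /rfix_mxP u_fix uj0.
apply: (row_full_sum_ortho_eq0 (v_full i)) => k; rewrite inE => ik.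
have [s [sS si sj]] := Sigma_arc _ _ _ _ ij ik.
have <- : u *m T s = u.
  by apply: u_fix; rewrite inE sS; exact/astab1P.
rewrite -{1}si -sj -!Tv // -mulmxBl trmx_mul mulmxA -(mulmxA u).
by rewrite Torth // mulmx1.
Qed.

Lemma equivariant_row_rfix T w i :
  equivariant T w -> (row i w <= rfix_mx T 'C_Sigma[i | 'P])%MS.
Proof.
move=> Tw; apply/rfix_mxP => s; rewrite inE => /andP[sS /astab1P si].
by rewrite Tw // -[s i]/('P%act i s) si.
Qed.

Lemma rfix_stab_sub_row T v i j :
    arc_transitive G Sigma -> orthogonal_rep T -> equivariant T v ->
    full_local_dimension G v -> adj G i j -> row i v != 0 ->
  (rfix_mx T 'C_Sigma[i | 'P] <= row i v)%MS.
Proof.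
move=> Sigma_arc Torth Tv v_full ij vi_neq0.
have ortho_eq0 (u : 'rV[R]_d) :=
  @rfix_stab_ortho_eq0 1 T v i j u Sigma_arc Torth Tv v_full ij.
pose c (u : 'rV[R]_d) := (u *m (row j v - row i v)^T) 0 0.
have cE u : u *m (row j v - row i v)^T = (c u)%:M by exact: mx11_scalar.
have vi_fix := equivariant_row_rfix i Tv.
have c_vi_neq0 : c (row i v) != 0.
  apply: contraNneq vi_neq0 => c0; apply/eqP/ortho_eq0 => //.
  by rewrite cE c0 raddf0.
apply/row_subP => k; set u := row k _; apply/sub_rVP.
exists (c u / c (row i v)).
apply/eqP; rewrite -subr_eq0; apply/eqP/ortho_eq0.
  by rewrite addmx_sub ?row_sub // eqmx_opp scalemx_sub.
by rewrite mulmxBl -scalemxAl !cE scale_scalar_mx divfK // subrr.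
Qed.

Lemma arc_transitive_spans_equivariant T v :
    (0 < n)%N -> arc_transitive G Sigma -> realizes T v ->
    full_local_dimension G v ->
  spans_equivariant T v.
Proof.
move=> n_gt0 Sigma_arc [Torth Tv] v_full w Tw.
have [d0|d_gt0] := posnP d.
  by exists 0; subst d; rewrite [w]thinmx0 [v]thinmx0 scaler0.
have has_nbr i : exists j, adj G i j by exact: full_local_dimension_nbr v_full.
have Strans := arc_transitive_atrans n_gt0 has_nbr Sigma_arc.
pose i := Ordinal n_gt0; have [j ij] := has_nbr i.
have vi_neq0 : row i v != 0.
  apply: contraTneq (full_local_dimension_row_full n_gt0 v_full) => vi0.
  rewrite (equivariant_row_inj (i := i) Strans Tv (equivariant0 T)) ?row0 //.
  by rewrite /row_full mxrank0 eq_sym -lt0n.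
have /sub_rVP[a wi] : (row i w <= row i v)%MS.
  apply: submx_trans (equivariant_row_rfix i Tw) _.
  exact: rfix_stab_sub_row ij vi_neq0.
exists a; apply: (equivariant_row_inj (i := i) Strans Tw (equivariantZ a Tv)).
by rewrite wi linearZ.
Qed.

End ArcTransitive.

Theorem theorem4p10 (R : realType) (n d : nat) (n_gt0 : (0 < n)%N)
    (G : graph n) (Sigma : {group 'S_n}) (v : 'M[R]_(n, d))
    (Sigma_aut : Sigma \subset graph_aut G)
    (Sigma_arc : arc_transitive G Sigma)
    (v_real : sigma_realization Sigma v)
    (v_full : full_local_dimension G v) :
  [/\ irreducible_realization Sigma v, rigid Sigma v & balanced G v].
Proof.
have v_row_full := full_local_dimension_row_full n_gt0 v_full.
have v_span T (Tv : realizes T v) : spans_equivariant T v :=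
  arc_transitive_spans_equivariant n_gt0 Sigma_arc Tv v_full.
have [T Tv] := v_real; split.
- split=> // T' T'v.
  exact: spans_equivariant_irreducible v_row_full T'v.2 (v_span T' T'v).
- exact: spans_equivariant_rigid Tv.2 (v_span T Tv).
- exact: spans_equivariant_balanced Sigma_aut Tv.2 (v_span T Tv).
Qed.
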